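(* Let $(G,H)$ be a rigid pair, let $(X,\nu)$ be an ergodic probability measure-preserving $G$-space and let $\varphi$ be a square-integrable measurable function on $X$ which is essentially $H$-invariant. Then, for every strictly increasing nested sequence $(F_n)$ of finite subsets of $G/H$, we have $$\lim_n\frac{1}{|F_n|}\sum_{s\in F_n}\varphi(s^{-1}x)=\int_X\varphi\,d\nu$$ for $\nu$-almost every $x\in X$.
   Context: Let $G$ be a countable group and $H$ a subgroup of $G$. The pair $(G,H)$ is rigid if whenever $(\mathcal{H},\pi)$ is a unitary representation of $G$ with no non-zero $\pi(G)$-invariant vectors and $v_o\in\mathcal{H}$ is a $\pi(H)$-invariant unit vector, then $\langle v_o,\pi(s)v_o\rangle=1$ if $s\in H$ and $\langle v_o,\pi(s)v_o\rangle=0$ if $s\in G\setminus H$. For $s=gH\in G/H$, $\varphi(s^{-1}x)$ means $\varphi(g^{-1}x)$, which for almost every $x$ does not depend on the representative $g$, because $\varphi$ is essentially $H$-invariant (i.e. for every $h\in H$, $\varphi(hx)=\varphi(x)$ for $\nu$-almost every $x$). ''Strictly increasing nested'' means $F_1\subsetneq F_2\subsetneq\cdots$. *)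

(* Defs.v *)
From HB Require Import structures.
From mathcomp Require Import all_boot all_order all_algebra.
From mathcomp Require Import generic_quotient sesquilinear complex finmap.
From mathcomp Require Import all_classical all_reals all_analysis.

Set Implicit Arguments.
Unset Strict Implicit.
Unset Printing Implicit Defensive.

Import Order.TTheory GRing.Theory Num.Theory.
Import numFieldNormedType.Exports.

Local Open Scope classical_set_scope.
Local Open Scope ring_scope.
Local Open Scope quotient_scope.

(* Inner products are linear in the first argument and conjugate-linear in the
   second. *)
Definition dot_norm (R : realType) (V : lmodType R[i])
    (dot : {dot V for @Num.conj R[i]}) (v : V) : R[i] :=
  sqrtC (dot v v).

(* Completeness for [dot_norm]. The order of R[i] compares only numbers with the
   same imaginary part, so [0 < e] says that e is real and positive. *)
Definition hilbert (R : realType) (V : lmodType R[i])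
    (dot : {dot V for @Num.conj R[i]}) : Prop :=
  forall u : nat -> V,
    (forall e : R[i], 0 < e -> exists N : nat, forall m n : nat,
       (N <= m)%N -> (N <= n)%N -> dot_norm dot (u m - u n) < e) ->
    exists l : V, forall e : R[i], 0 < e -> exists N : nat, forall n : nat,
       (N <= n)%N -> dot_norm dot (u n - l) < e.

(* Each [rep g] is invertible, with inverse [rep g^-1], so that preserving the
   inner product makes it unitary. *)
Record unitary_rep (R : realType) (G : groupType) (V : lmodType R[i])
    (dot : {dot V for @Num.conj R[i]}) := UnitaryRep {
  rep :> G -> {linear V -> V};
  rep1 : forall v : V, rep 1%g v = v;
  repM : forall (g h : G) (v : V), rep (g * h)%g v = rep g (rep h v);
  rep_dot : forall (g : G) (u v : V), dot (rep g u) (rep g v) = dot u v }.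

Definition rigid_pair (R : realType) (G : groupType) (H : groupClosed G)
  : Prop :=
  forall (V : lmodType R[i]) (dot : {dot V for @Num.conj R[i]}),
    hilbert dot ->
  forall pi : unitary_rep G dot,
    (forall v : V, (forall g : G, pi g v = v) -> v = 0) ->
  forall v0 : V, dot_norm dot v0 = 1 ->
    (forall h : G, h \in H -> pi h v0 = v0) ->
  forall s : G,
    (s \in H -> dot v0 (pi s v0) = 1) /\ (s \notin H -> dot v0 (pi s v0) = 0).

Definition lcoset_rel (G : groupType) (H : groupClosed G) : rel G :=
  fun g h => (g^-1 * h)%g \in H.

Lemma lcoset_rel_refl (G : groupType) (H : groupClosed G) :
  reflexive (lcoset_rel H).
Proof. by move=> g; rewrite /lcoset_rel mulVg gpred1. Qed.

Lemma lcoset_rel_sym (G : groupType) (H : groupClosed G) :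
  symmetric (lcoset_rel H).
Proof. by move=> g h; rewrite /lcoset_rel -gpredV invgM invgK. Qed.

Lemma lcoset_rel_trans (G : groupType) (H : groupClosed G) :
  transitive (lcoset_rel H).
Proof.
move=> h g k; rewrite /lcoset_rel => gh hk.
by have := gpredM _ _ gh hk; rewrite mulgA mulgK.
Qed.

Canonical lcoset_equiv (G : groupType) (H : groupClosed G) : equiv_rel G :=
  EquivRel (lcoset_rel H) (@lcoset_rel_refl G H) (@lcoset_rel_sym G H)
    (@lcoset_rel_trans G H).

(* G/H *)
Definition lcosets (G : groupType) (H : groupClosed G) : Type :=
  {eq_quot lcoset_equiv H}.

HB.instance Definition _ (G : groupType) (H : groupClosed G) :=
  Choice.on (lcosets H).
HB.instance Definition _ (G : groupType) (H : groupClosed G) :=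
  EqQuotient.on (lcosets H).

Definition coset_section (G : groupType) (H : groupClosed G)
    (r : lcosets H -> G) : Prop :=
  forall s : lcosets H, \pi_(lcosets H) (r s) = s.

Record pmp_space (R : realType) (G : groupType) (d : measure_display)
    (X : measurableType d) (nu : probability X R) := PmpSpace {
  act :> G -> X -> X;
  act1 : forall x : X, act 1%g x = x;
  actM : forall (g h : G) (x : X), act (g * h)%g x = act g (act h x);
  measurable_act : forall g : G, measurable_fun [set: X] (act g);
  act_preserving : forall (g : G) (A : set X),
    measurable A -> nu (act g @^-1` A) = nu A }.

Definition ergodic (R : realType) (G : groupType) (d : measure_display)
    (X : measurableType d) (nu : probability X R) (a : pmp_space G nu) : Prop :=
  forall A : set X, measurable A -> (forall g : G, a g @^-1` A = A) ->
    nu A = 0%E \/ nu A = 1%E.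

Definition complex_measurable (R : realType) (d : measure_display)
    (X : measurableType d) (f : X -> R[i]) : Prop :=
  measurable_fun [set: X] (fun x => complex.Re (f x)) /\
  measurable_fun [set: X] (fun x => complex.Im (f x)).

Definition square_integrable (R : realType) (d : measure_display)
    (X : measurableType d) (nu : probability X R) (f : X -> R[i]) : Prop :=
  (\int[nu]_x ((Normc.normc (f x)) ^+ 2)%:E < +oo)%E.

Definition complex_integral (R : realType) (d : measure_display)
    (X : measurableType d) (nu : probability X R) (f : X -> R[i]) : R[i] :=
  Complex (\int[nu]_x complex.Re (f x)) (\int[nu]_x complex.Im (f x)).

Definition essentially_invariant (R : realType) (G : groupType)
    (H : groupClosed G) (d : measure_display) (X : measurableType d)
    (nu : probability X R) (a : pmp_space G nu) (f : X -> R[i]) : Prop :=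
  forall h : G, h \in H -> {ae nu, forall x, f (a h x) = f x}.

(* The average of f (s^-1 x) over s in F, where s^-1 x is computed with the
   representative [r s] of the coset s. *)
Definition coset_average (R : realType) (G : groupType) (H : groupClosed G)
    (d : measure_display) (X : measurableType d) (nu : probability X R)
    (a : pmp_space G nu) (f : X -> R[i]) (r : lcosets H -> G)
    (F : {fset lcosets H}) (x : X) : R[i] :=
  (#|` F|%:R)^-1 * \sum_(s <- F) f (a (r s)^-1%g x).

(* Main.v *)
(* A square-integrable real f that is essentially H-invariant has translates
   over distinct cosets that are pairwise uncorrelated: rigidity is applied to
   the Koopman representation on L^2 modulo constants, which has no invariant
   vectors by ergodicity. Pairwise uncorrelated variables with bounded variances
   obey the strong law of large numbers: along the squares the second moments of
   the averages are summable, and Cauchy-Schwarz controls the sums over the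
   blocks between consecutive squares. An increasing sequence of finite sets of
   cosets is a sequence of initial segments of one enumeration, so its averages
   are a subsequence of these. *)
Require Import Defs.
From HB Require Import structures.
From mathcomp Require Import all_boot all_order all_algebra.
From mathcomp Require Import generic_quotient sesquilinear complex finmap.
From mathcomp Require Import all_classical all_reals all_analysis.
From mathcomp Require Import measurable_realfun random_variable ring lra zify.
Import Order.TTheory GRing.Theory Num.Theory.
Import numFieldNormedType.Exports.

Set Implicit Arguments.
Unset Strict Implicit.
Unset Printing Implicit Defensive.

Local Open Scope classical_set_scope.
Local Open Scope ring_scope.

(** * Hilbert space attached to a positive semidefinite form *)

(** [rigid_pair] concerns complex Hilbert spaces with a definite inner product, whereas covariance
    is a degenerate form on a real space of functions. Quotient and complexification are therefore
    built for an arbitrary positive semidefinite form, and completeness, invariance and absence of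
    invariant vectors are checked on real functions up to null vectors. A vector fixed in the
    quotient by constants may a priori change by a constant under each group element; preservation
    of the measure makes that constant zero. It is then fixed only almost everywhere, whereas
    [ergodic] speaks of strictly invariant sets, and the countability of [G] bridges this gap.
    Orthogonality alone gives an average of [n] terms a variance of order [1/n], which is not
    summable; at [n = k^2] it is of order [1/k^2]. A block between consecutive squares has about
    [2k] terms, so by Cauchy-Schwarz its sum has second moment of order [k^2], and division by [k^4]
    gives [1/k^2] again. *)

Record psd_form (R : realType) (E : lmodType R) := PsdForm {
  psdf :> E -> E -> R;
  psdfC : forall u v, psdf u v = psdf v u;
  psdfD : forall u v w, psdf (u + v) w = psdf u w + psdf v w;
  psdfZ : forall c u w, psdf (c *: u) w = c * psdf u w;
  psdf_ge0 : forall u, 0 <= psdf u u }.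

Section PsdFormTheory.
Context {R : realType} {E : lmodType R} (B : psd_form E).

Lemma psdfDr u v w : B w (u + v) = B w u + B w v.
Proof. by rewrite psdfC psdfD !(psdfC _ w). Qed.

Lemma psdfZr c u w : B w (c *: u) = c * B w u.
Proof. by rewrite psdfC psdfZ (psdfC _ w). Qed.

Lemma psdfN u w : B (- u) w = - B u w.
Proof. by rewrite -scaleN1r psdfZ mulN1r. Qed.

Lemma psdf0 w : B 0 w = 0.
Proof. by rewrite -(scale0r 0) psdfZ mul0r. Qed.

Lemma psdf0r w : B w 0 = 0.
Proof. by rewrite psdfC psdf0. Qed.

(** At [t u + w] the form has no quadratic term in [t]. An affine function of [t] that is never
    negative has slope zero; otherwise the [t] chosen below would give the value -1. *)
Lemma psdf_null u w : B u u = 0 -> B u w = 0.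
Proof.
move=> u0.
have H t : 0 <= t * (2 * B u w) + B w w.
  have := psdf_ge0 B (t *: u + w).
  rewrite psdfD !psdfDr !psdfZ !psdfZr u0 (psdfC _ w u); lra.
apply/eqP/negPn/negP => b0.
have := H (- (B w w + 1) / (2 * B u w)).
rewrite divfK ?mulf_neq0 ?pnatr_eq0//; lra.
Qed.

(* The complexification of E modulo the null vectors of B, in one step: u + i v
   is encoded as the function z |-> B u z + i B v z, so that vectors differing
   by null vectors become equal. *)
Definition functional_of (u v : E) : E -> R[i]^o :=
  fun z => Complex (B u z) (B v z).

Definition is_functional : {pred E -> R[i]^o} :=
  fun F => `[< exists u v, F = functional_of u v >].

Lemma is_functionalP F :
  reflect (exists u v, F = functional_of u v) (F \in is_functional).
Proof. exact: asboolP. Qed.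

Lemma is_functional_submod : submod_closed is_functional.
Proof.
split.
  apply/is_functionalP; exists 0, 0; apply/funext => z.
  by rewrite /functional_of !psdf0.
move=> [a b] _ _ /is_functionalP[u [v ->]] /is_functionalP[u' [v' ->]].
apply/is_functionalP.
(* Real and imaginary parts of [(a + i b)(u + i v) + (u' + i v')]. *)
exists (a *: u - b *: v + u'), (a *: v + b *: u + v').
apply/funext => z.
by rewrite /functional_of !psdfD psdfN !psdfZ.
Qed.

HB.instance Definition _ := GRing.isSubmodClosed.Build R[i] _ is_functional
  is_functional_submod.

Definition hilbert_space : Type := {F : E -> R[i]^o | F \in is_functional}.
HB.instance Definition _ := [isSub of hilbert_space for @sval _ _].
HB.instance Definition _ := [Choice of hilbert_space by <:].
HB.instance Definition _ :=
  [SubChoice_isSubLmodule of hilbert_space by <:].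


Lemma functional_of_in u v : functional_of u v \in is_functional.
Proof. by apply/is_functionalP; exists u, v. Qed.

Definition hvec u v : hilbert_space :=
  exist _ (functional_of u v) (functional_of_in u v).

Lemma hvec_surj F : exists uv : E * E, F = hvec uv.1 uv.2.
Proof.
have /is_functionalP[u [v Fuv]] := valP F.
by exists (u, v); apply/val_inj.
Qed.

Definition hrep F : E * E := sval (cid (hvec_surj F)).

Lemma hrepK F : hvec (hrep F).1 (hrep F).2 = F.
Proof. by rewrite /hrep; case: cid. Qed.

(** If [G] comes from [p + i q], conjugate-linearity in [G] leaves [F(p) - i F(q)]. Only [G] needs a
    chosen representative, so linearity in [F] is immediate; [hdotE] shows that the choice does not
    matter. *)
Definition hdot (F G : hilbert_space) : R[i] :=
  sval F (hrep G).1 - 'i%C * sval F (hrep G).2.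

Lemma hvec_inj u v u' v' w : hvec u v = hvec u' v' ->
  B u w = B u' w /\ B v w = B v' w.
Proof. by move/(congr1 sval)/(congr1 (fun F => F w)) => [] . Qed.

Lemma hdotE u v u' v' : hdot (hvec u v) (hvec u' v') =
  Complex (B u u' + B v v') (B v u' - B u v').
Proof.
have H w := hvec_inj w (hrepK (hvec u' v')).
rewrite /hdot /=.
move: H; case: (hrep _) => p q /= H.
rewrite /functional_of !(psdfC _ _ p) !(psdfC _ _ q) !(H _).1 !(H _).2.
rewrite !(psdfC _ u) !(psdfC _ v).
apply/eqP; rewrite eq_complex /=; apply/andP; split; apply/eqP; ring.
Qed.

Lemma hvecB u v u' v' : hvec u v - hvec u' v' = hvec (u - u') (v - v').
Proof.
apply/val_inj/funext => z /=.
by rewrite /functional_of !psdfD !psdfN.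
Qed.

Lemma hdotC F G : hdot F G = (-1) ^+ false * Num.conj (hdot G F).
Proof.
rewrite expr0 mul1r -(hrepK F) -(hrepK G) !hdotE.
case: (hrep F) (hrep G) => u v [u' v'] /=.
rewrite (psdfC _ u' u) (psdfC _ v' v) (psdfC _ v' u) (psdfC _ u' v).
by apply/eqP; rewrite eq_complex /= opprB !eqxx.
Qed.

Lemma hdot_linearl G : linear_for *%R (hdot ^~ G).
Proof. 
move=> c F F'.
have lin z : sval (c *: F + F') z = c * sval F z + sval F' z :> R[i] by [].
rewrite /hdot !lin.
move: (sval F _) (sval F _) (sval F' _) (sval F' _) => /= p q p' q'.
by ring.
Qed.

Lemma hdot_bilinear : bilinear_for *%R (Num.conj \; *%R) hdot.
Proof.
split => [G|F c G G'].
  exact: hdot_linearl.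
rewrite [LHS]hdotC [X in _ = _ + X]hdotC [X in _ = (_ \; _) _ X + _]hdotC.
by rewrite !expr0 !mul1r hdot_linearl rmorphD rmorphM.
Qed.

HB.instance Definition _ := bilinear_isBilinear.Build R[i]
  hilbert_space hilbert_space R[i] *%R (Num.conj \; *%R) hdot
  hdot_bilinear.
HB.instance Definition _ := isHermitianSesquilinear.Build R[i]
  hilbert_space false Num.conj hdot hdotC.

Lemma hdot_gt0 F : F != 0 -> 0 < hdot F F.
Proof.
move=> F0; rewrite -(hrepK F) hdotE; move: (hrepK F) F0.
case: (hrep F) => u v /= <- uv0.
rewrite ltcE /= (psdfC _ v u) subrr eqxx /=.
rewrite lt_def addr_ge0 ?psdf_ge0// andbT.
apply: contra uv0; rewrite paddr_eq0 ?psdf_ge0// => /andP[/eqP u0 /eqP v0].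
apply/eqP/val_inj/funext => z /=.
by rewrite /functional_of (psdf_null z u0) (psdf_null z v0).
Qed.

HB.instance Definition _ := isDotProduct.Build R[i] hilbert_space hdot
  hdot_gt0.

Definition hilbert_dot : {dot hilbert_space for @Num.conj R[i]} := hdot.

(** Brings the complex-valued norm back to the real form: [0 < e] makes [e] real, and squaring two
    nonnegative numbers removes [sqrtC]. *)
Lemma hilbert_norm_lt u v (e : R[i]) : 0 < e ->
  (dot_norm hilbert_dot (hvec u v) < e) =
  (B u u + B v v < complex.Re e ^+ 2).
Proof.
case: e => e b eb0.
have [b0 e0] : b = 0 /\ 0 < e.
  by move: eb0; rewrite ltcE /= => /andP[/eqP].
rewrite {}b0 {eb0}.
have E0 : 0 <= (Complex e 0 : R[i]) by rewrite lecE /= eqxx ltW.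
have D0 : 0 <= sqrtC (hilbert_dot (hvec u v) (hvec u v)).
  rewrite sqrtC_ge0; have [->|/hdot_gt0/ltW//] := eqVneq (hvec u v) 0.
  by rewrite linear0l.
have := @ltr_pXn2r R[i] 2 isT _ _ D0 E0.
rewrite sqrtCK => sqr_lt; apply: etrans (esym sqr_lt) _.
rewrite [hilbert_dot _ _]hdotE ltcE /= (psdfC _ v u) subrr.
by rewrite !mulr0 !mul0r addr0 eqxx subr0.
Qed.

(** Distances are squared, so no square root is needed; [l] is determined only up to null vectors,
    which the quotient identifies. *)
Definition psd_complete := forall u : nat -> E,
  (forall e : R, 0 < e -> exists N : nat, forall m n : nat,
     (N <= m)%N -> (N <= n)%N -> B (u m - u n) (u m - u n) < e) ->
  exists l : E, forall e : R, 0 < e -> exists N : nat, forall n : nat,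
     (N <= n)%N -> B (u n - l) (u n - l) < e.

Lemma hilbert_space_complete : psd_complete -> hilbert hilbert_dot.
Proof.
move=> cB w cw.
pose u n := (hrep (w n)).1; pose v n := (hrep (w n)).2.
have wE n : w n = hvec (u n) (v n) by rewrite hrepK.
(* Norm tolerance [Num.sqrt e] is squared tolerance [e]; it bounds a sum of two nonnegative terms,
   hence the real and the imaginary part separately. *)
have cauchy m n (e : R) : 0 < e ->
    (dot_norm hilbert_dot (w m - w n) < Complex (Num.sqrt e) 0) ->
    B (u m - u n) (u m - u n) < e /\ B (v m - v n) (v m - v n) < e.
  move=> e0; rewrite !wE hvecB hilbert_norm_lt; last first.
    by rewrite ltcE /= eqxx sqrtr_gt0.
  rewrite /= sqr_sqrtr ?ltW// => h.
  have := psdf_ge0 B (u m - u n); have := psdf_ge0 B (v m - v n).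
  by split; lra.
have sqrtC0 (e : R) : 0 < e -> 0 < Complex (Num.sqrt e) 0 :> R[i].
  by move=> e0; rewrite ltcE /= eqxx sqrtr_gt0.
have [l hl] : exists l : E, forall e : R, 0 < e -> exists N : nat,
    forall n : nat, (N <= n)%N -> B (u n - l) (u n - l) < e.
  apply: cB => e e0; have [N HN] := cw _ (sqrtC0 _ e0).
  by exists N => m n Nm Nn; have [] := cauchy m n e e0 (HN _ _ Nm Nn).
have [l' hl'] : exists l : E, forall e : R, 0 < e -> exists N : nat,
    forall n : nat, (N <= n)%N -> B (v n - l) (v n - l) < e.
  apply: cB => e e0; have [N HN] := cw _ (sqrtC0 _ e0).
  by exists N => m n Nm Nn; have [] := cauchy m n e e0 (HN _ _ Nm Nn).
exists (hvec l l') => e e0.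
have e20 : 0 < complex.Re e ^+ 2 / 2.
  by rewrite divr_gt0// exprn_gt0//; move: e0; rewrite ltcE => /andP[].
have [N HN] := hl _ e20; have [N' HN'] := hl' _ e20.
exists (maxn N N') => n; rewrite geq_max => /andP[/HN h /HN' h'].
by rewrite wE hvecB hilbert_norm_lt//; lra.
Qed.

End PsdFormTheory.

(** * The unitary representation induced by an isometric action *)

Record isometric_action (R : realType) (G : groupType) (E : lmodType R)
    (B : psd_form E) := IsometricAction {
  iact :> G -> E -> E;
  iact1 : forall u, iact 1%g u = u;
  iactM : forall g h u, iact (g * h)%g u = iact g (iact h u);
  iact_isom : forall g u v, B (iact g u) (iact g v) = B u v }.

Section HilbertRep.
Context {R : realType} {G : groupType} {E : lmodType R} {B : psd_form E}.
Variable T : isometric_action G B.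

Lemma iactV g u v : B (T g u) v = B u (T g^-1%g v).
Proof. by rewrite -(iact_isom T g u) -iactM mulgV iact1. Qed.

Lemma hilbert_act_in g (F : hilbert_space B) :
  (fun z => sval F (T g^-1%g z)) \in is_functional B.
Proof.
rewrite -(hrepK F); apply/is_functionalP.
exists (T g (hrep F).1), (T g (hrep F).2); apply/funext => z.
by rewrite /= /functional_of !iactV.
Qed.

(** Precomposition with [T g^-1], hence linear in [F] by construction. It sends the functional of
    [u + i v] to that of [T g u + i T g v] because [T g^-1] is the adjoint of [T g] ([iactV]). *)
Definition hilbert_act g (F : hilbert_space B) : hilbert_space B :=
  @exist _ (fun F => F \in is_functional B) _ (hilbert_act_in g F).

Lemma hilbert_act_linear g : linear (hilbert_act g).
Proof. by move=> c F F'; apply/val_inj. Qed.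

HB.instance Definition _ g := GRing.isLinear.Build R[i] (hilbert_space B)
  (hilbert_space B) _ (hilbert_act g) (hilbert_act_linear g).

Lemma hilbert_act_hvec g u v :
  hilbert_act g (hvec B u v) = hvec B (T g u) (T g v).
Proof.
by apply/val_inj/funext => z; rewrite /= /functional_of !iactV.
Qed.

Lemma hilbert_act1 F : hilbert_act 1%g F = F.
Proof. by rewrite -(hrepK F) hilbert_act_hvec !iact1. Qed.

Lemma hilbert_actM g h F :
  hilbert_act (g * h)%g F = hilbert_act g (hilbert_act h F).
Proof. by rewrite -(hrepK F) !hilbert_act_hvec !iactM. Qed.

Lemma hilbert_act_dot g F F' :
  hilbert_dot B (hilbert_act g F) (hilbert_act g F') =
  hilbert_dot B F F'.
Proof.
rewrite -(hrepK F) -(hrepK F') !hilbert_act_hvec.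
by rewrite [LHS]hdotE [RHS]hdotE !iact_isom.
Qed.

Definition hilbert_rep : unitary_rep G (hilbert_dot B) :=
  @UnitaryRep R G (hilbert_space B) (hilbert_dot B)
    (fun g => hilbert_act g : {linear _ -> _})
    hilbert_act1 hilbert_actM hilbert_act_dot.

Lemma hvec_eq u v u' v' : B (u - u') (u - u') = 0 -> B (v - v') (v - v') = 0 ->
  hvec B u v = hvec B u' v'.
Proof.
move=> uu vv; apply/val_inj/funext => z.
have := psdf_null z uu; have := psdf_null z vv.
rewrite !psdfD !psdfN => /eqP; rewrite subr_eq0 => /eqP vE.
by move=> /eqP; rewrite subr_eq0 => /eqP uE; rewrite /= /functional_of uE vE.
Qed.

(** Invariance up to null vectors becomes true invariance in the Hilbert space, so rigidity applies
    to the normalized image of [v], taken with imaginary part 0. *)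
Lemma rigid_pair_orthogonal (H : groupClosed G) (v : E) (s : G) :
  rigid_pair R H -> psd_complete B ->
  (forall u, (forall g, B (T g u - u) (T g u - u) = 0) -> B u u = 0) ->
  (forall h, h \in H -> B (T h v - v) (T h v - v) = 0) ->
  s \notin H -> B v (T s v) = 0.
Proof.
move=> rigH cB noinv Hv sH.
(* A null [v] cannot be normalized, but it is orthogonal to everything. *)
have [v0|v_neq0] := eqVneq (B v v) 0; first exact: psdf_null.
have v_gt0 : 0 < B v v by rewrite lt_def v_neq0 psdf_ge0.
pose c := (Num.sqrt (B v v))^-1.
have c2 : c ^+ 2 * B v v = 1.
  by rewrite /c exprVn sqr_sqrtr ?ltW// mulVf.
have cneq0 : c != 0 by rewrite invr_eq0 gt_eqF// sqrtr_gt0.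
have noinvV w : (forall g, hilbert_rep g w = w) -> w = 0.
  move=> winv; have hinv g z : B (T g (hrep w).1 - (hrep w).1) z = 0 /\
      B (T g (hrep w).2 - (hrep w).2) z = 0.
    have : hilbert_act g w = w by exact: winv.
    rewrite -{1 2}(hrepK w) hilbert_act_hvec => /(hvec_inj z)[h1 h2].
    by rewrite !psdfD !psdfN h1 h2 !subrr.
  rewrite -(hrepK w).
  have -> : 0 = hvec B 0 0.
    by apply/val_inj/funext => z; rewrite /= /functional_of !psdf0.
  by apply: hvec_eq; rewrite subr0; apply: noinv => g; have [] := hinv g 0;
    have [? ?] := hinv g (T g (hrep w).1 - (hrep w).1);
    have [? ?] := hinv g (T g (hrep w).2 - (hrep w).2).
have w1 : dot_norm (hilbert_dot B) (hvec B (c *: v) 0) = 1.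
  rewrite /dot_norm [hilbert_dot _ _ _]hdotE.
  rewrite !psdfZ !psdfZr !psdf0 !psdf0r mulr0 subrr addr0 mulrA -expr2 c2.
  by rewrite (_ : Complex 1 0 = 1)// sqrtC1.
have winv h : h \in H ->
    hilbert_rep h (hvec B (c *: v) 0) = hvec B (c *: v) 0.
  move=> hH; apply/val_inj/funext => z /=; rewrite /functional_of.
  have /eqP := psdf_null z (Hv h hH).
  rewrite psdfD psdfN subr_eq0 iactV => /eqP hz.
  by rewrite !psdf0 !psdfZ hz.
have [_ /(_ sH)] :=
  rigH _ _ (hilbert_space_complete cB) hilbert_rep noinvV _ w1 winv s.
rewrite [X in hilbert_dot _ _ X]hilbert_act_hvec [LHS]hdotE.
move=> /(congr1 (@complex.Re R)) /=.
(* [T s] carries no linearity: to take the second factor [c] out, it is moved across the form as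
   [T s^-1] and then back. *)
rewrite psdf0 addr0 psdfZ psdfC iactV psdfZ mulrA -expr2 -iactV psdfC => /eqP.
by rewrite mulf_eq0 sqrf_eq0 (negPf cneq0) => /eqP.
Qed.
End HilbertRep.

(** * Riesz-Fischer *)

(* AM-GM: [|b| = (c b^2)^(1/2) (1/c)^(1/2)] *)
Lemma ler_norm_sqr (R : realFieldType) (b c : R) :
  0 < c -> `|b| <= c * b ^+ 2 + c^-1.
Proof.
move=> c0; rewrite -(real_normK (num_real b)).
move: `|b| (normr_ge0 b) => {}b b0.
have ci : 0 < c^-1 by rewrite invr_gt0.
have : 0 <= c * (b - c^-1 / 2) ^+ 2 by rewrite mulr_ge0 ?sqr_ge0// ltW.
have -> : c * (b - c^-1 / 2) ^+ 2 = c * b ^+ 2 - b + c^-1 / 4.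
  by field; rewrite gt_eqF.
by move: (c * b ^+ 2) (c^-1) ci => p q; lra.
Qed.

Lemma nneseries_lty_is_cvg (R : realType) (a : nat -> R) :
  (forall n, 0 <= a n) -> (\sum_(0 <= k <oo) (a k)%:E < +oo)%E ->
  cvgn (series a).
Proof.
move=> a0 aoo.
have s0 : (0 <= \sum_(0 <= k <oo) (a k)%:E)%E.
  by apply: nneseries_ge0 => k _ _; rewrite lee_fin.
apply: nondecreasing_is_cvgn.
  by apply/nondecreasing_seqP => n; rewrite seriesEnat /= big_nat_recr//= lerDl.
exists (fine (\sum_(0 <= k <oo) (a k)%:E)) => _ [n _ <-].
rewrite -lee_fin fineK ?ge0_fin_numE// seriesEnat /= -sumEFin.
by apply: nneseries_lim_ge => k _; rewrite lee_fin.
Qed.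

Lemma nneseries_le (R : realType) (a : nat -> \bar R) (c : \bar R) :
  (forall n, 0 <= a n)%E -> (forall n, \sum_(0 <= k < n) a k <= c)%E ->
  (\sum_(0 <= k <oo) a k <= c)%E.
Proof.
move=> a0 ac; apply: lime_le; first by apply: is_cvg_nneseries => n _ _.
by apply: nearW => n; exact: ac.
Qed.

Lemma measurable_nneseries d (T : measurableType d) (R : realType)
    (f : nat -> T -> R) :
  (forall n, measurable_fun setT (f n)) -> (forall n x, 0 <= f n x) ->
  measurable_fun setT (fun x => \sum_(0 <= k <oo) (f k x)%:E)%E.
Proof.
move=> mf f0.
apply: (@emeasurable_fun_cvg _ _ _ setT
  (fun n x => \sum_(0 <= k < n) (f k x)%:E)%E) => [n|x _].
  by apply: emeasurable_sum => k; exact/measurable_EFinP.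
by apply: is_cvg_nneseries => k _ _; rewrite lee_fin.
Qed.

Section AeSummable.
Context d (T : measurableType d) (R : realType).
Variable mu : {measure set T -> \bar R}.
Local Open Scope ereal_scope.

Lemma ae_summable (f : nat -> T -> R) :
  (forall n, measurable_fun setT (f n)) -> (forall n x, (0 <= f n x)%R) ->
  \sum_(0 <= k <oo) \int[mu]_x (f k x)%:E < +oo ->
  {ae mu, forall x, \sum_(0 <= k <oo) (f k x)%:E < +oo}.
Proof.
move=> mf f0 foo.
have mEf n : measurable_fun setT (fun x => (f n x)%:E).
  exact/measurable_EFinP.
have f0E n x : @setT T x -> 0 <= (f n x)%:E by rewrite lee_fin.
have sum0 x : 0 <= \sum_(0 <= k <oo) (f k x)%:E.
  by apply: nneseries_ge0 => k _ _; rewrite lee_fin.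
have : mu.-integrable setT (fun x => \sum_(0 <= k <oo) (f k x)%:E).
  apply/integrableP; split.
    exact: measurable_nneseries.
  under eq_integral do rewrite gee0_abs//.
  by rewrite integral_nneseries.
move=> /(integrable_ae measurableT); apply: filterS => x /(_ I).
by rewrite ge0_fin_numE.
Qed.

(** The sum of the [f n] has finite integral, so it is finite almost everywhere and its terms tend
    to 0. This is the only source of almost sure convergence in the law of large numbers below. *)
Lemma ae_cvg0 (f : nat -> T -> R) :
  (forall n, measurable_fun setT (f n)) -> (forall n x, (0 <= f n x)%R) ->
  \sum_(0 <= k <oo) \int[mu]_x (f k x)%:E < +oo ->
  {ae mu, forall x, f n x @[n --> \oo] --> 0%R}.
Proof.
move=> mf f0 /(ae_summable mf f0); apply: filterS => x fx.
by apply: cvg_series_cvg_0; exact: nneseries_lty_is_cvg.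
Qed.

(** A rapidly Cauchy subsequence converges almost everywhere; Fatou's lemma then turns the Cauchy
    estimate into an estimate on the distance to its limit. *)
Lemma L2_complete (w : nat -> T -> R) :
  (forall n, measurable_fun setT (w n)) ->
  (forall e : R, (0 < e)%R -> exists N, forall m n, (N <= m)%N -> (N <= n)%N ->
    \int[mu]_x ((w m x - w n x) ^+ 2)%:E < e%:E) ->
  exists2 g : T -> R, measurable_fun setT g &
    forall e : R, (0 < e)%R -> exists N, forall n, (N <= n)%N ->
      \int[mu]_x ((w n x - g x) ^+ 2)%:E < e%:E.
Proof.
move=> mw cw.
have half_gt0 : (0 < 2^-1 :> R)%R by rewrite invr_gt0.
have half_lt1 : (`|2^-1 : R| < 1)%R by rewrite gtr0_norm// invf_lt1 ?ltr1n.
(* The rate [4^-k] pays for the weight [2^k] in [Y] and still leaves the summable [2^-k]. *)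
pose q k : R := (4%:R ^- k)%R.
have q0 k : (0 < q k)%R by rewrite /q invr_gt0 exprn_gt0.
have [N0 HN0] := choice (fun k => cw _ (q0 k)).
(* The thresholds [N0] need not be monotone; their running maximum satisfies all the earlier ones at
   once. *)
pose N k := (\max_(i < k.+1) N0 i)%N.
have N0N k j : (k <= j)%N -> (N0 k <= N j)%N.
  move=> kj; rewrite /N.
  exact: (@leq_bigmax _ (fun i : 'I_j.+1 => N0 i) (Ordinal (kj : k < j.+1)%N)).
have HN k m n : (N0 k <= m)%N -> (N0 k <= n)%N ->
    \int[mu]_x ((w m x - w n x) ^+ 2)%:E < (q k)%:E by exact: HN0.
pose D k x := (w (N k.+1) x - w (N k) x)%R.
(* By [ler_norm_sqr] with [c = 2^k], [|D k x|] is at most [Y k x + 2^-k]. Summability of the squares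
   weighted in this way thus gives absolute convergence of the telescoping series. *)
pose Y k x := (2 ^+ k * D k x ^+ 2)%R.
have mY k : measurable_fun setT (Y k).
  apply: measurable_funM => //; apply: measurable_funX.
  exact: measurable_funB.
have Y0 k x : (0 <= Y k x)%R by rewrite mulr_ge0 ?sqr_ge0// exprn_ge0.
have sY : \sum_(0 <= k <oo) \int[mu]_x (Y k x)%:E < +oo.
  apply: (@le_lt_trans _ _ (\sum_(0 <= k <oo) ((2^-1) ^+ k)%:E)).
    apply: lee_nneseries => // k _.
      by rewrite integral_ge0// => x _; rewrite lee_fin.
    rewrite /Y; under eq_integral do rewrite EFinM.
    rewrite ge0_integralZl//; last 2 first.
    - by apply/measurable_EFinP; apply: measurable_funX; apply: measurable_funB.
    - by move=> x _; rewrite lee_fin sqr_ge0.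
    apply: (@le_trans _ _ ((2 ^+ k)%:E * (q k)%:E)).
      apply: lee_wpmul2l; first by rewrite lee_fin exprn_ge0.
      by apply: ltW; apply: HN; apply: N0N.
    rewrite -EFinM lee_fin /q exprVn (_ : 4%:R = 2 * 2 :> R)%R; last by ring.
    by rewrite exprMn invfM mulrA divff ?mul1r// expf_neq0.
  apply: (@le_lt_trans _ _ 2%:E); last exact: ltry.
  apply: nneseries_le => [k|n]; first by rewrite lee_fin exprn_ge0.
  rewrite sumEFin lee_fin.
  have := @geometric_le_lim R n 1 2^-1 ler01 half_gt0 half_lt1.
  rewrite /geometric seriesEnat/=.
  under eq_bigr do rewrite mul1r.
  move=> /le_trans; apply.
  rewrite (_ : 1 - 2^-1 = 2^-1 :> R)%R; last by lra.
  by rewrite invrK mul1r.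
pose S := [set x : T | \sum_(0 <= k <oo) (Y k x)%:E < +oo].
have mS : measurable S.
  rewrite -[S]setTI; apply: emeasurable_fun_infty_o => //.
  exact: measurable_nneseries.
have aeS : {ae mu, forall x, S x} by exact: ae_summable.
have cvgw x : S x -> cvgn (fun k => w (N k) x).
  move=> Sx; pose u k := w (N k) x.
  suff /cvg_ex[l ul] : cvgn (series (telescope u)).
    apply/cvg_ex; exists (u 0%N + l)%R.
    rewrite [X in X @ _](_ : _ = fun k => u 0%N + series (telescope u) k)%R.
      by apply: cvgD => //; exact: cvg_cst.
    by apply/funext => k; rewrite -eq_sum_telescope.
  apply: normed_cvg.
  have cY : cvgn (series (Y ^~ x)) by exact: nneseries_lty_is_cvg.
  have cG : cvgn (series (geometric 1 (2^-1 : R))).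
    exact: is_cvg_geometric_series.
  apply: series_le_cvg (is_cvg_seriesD cY cG) => k //=.
    by rewrite addr_ge0// mulr_ge0// exprn_ge0// ltW.
  rewrite fctE /= /telescope -/(D k x) /Y mul1r exprVn.
  by apply: ler_norm_sqr; rewrite exprn_gt0.
(* Cutting off outside [S] makes the sequence converge everywhere, so that its limit is
   measurable. *)
pose h k x := (w (N k) x * \1_S x)%R.
have cvgh x : cvgn (h ^~ x).
  rewrite /h indicE; have [/set_mem Sx|] := boolP (x \in S).
    by apply: is_cvgMl; exact: cvgw.
  by move=> _; under eq_fun do rewrite mulr0; exact: is_cvg_cst.
pose g x := limn (h ^~ x).
have mg : measurable_fun setT g.
  apply: (@measurable_fun_cvg _ _ _ setT h) => [k|x _]; last exact: cvgh.
  exact: measurable_funM.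
exists g => // e e0.
have [k ke] : exists k, (q k < e)%R.
  have quarter_lt1 : (`|4^-1 : R| < 1)%R.
    by rewrite gtr0_norm ?invr_gt0// invf_lt1 ?ltr1n.
  have /cvgrPdist_lt/(_ _ e0)[k _ /(_ k (leqnn k))] := cvg_expr quarter_lt1.
  rewrite sub0r normrN ger0_norm ?exprn_ge0 ?invr_ge0//= => ke.
  by exists k; rewrite /q -exprVn.
exists (N0 k) => n kn.
apply: le_lt_trans (_ : (q k)%:E < e%:E); last by rewrite lte_fin.
have mwg j : measurable_fun setT (fun x => ((w n x - w (N j) x) ^+ 2)%:E).
  by apply/measurable_EFinP/measurable_funX; exact: measurable_funB.
have -> : \int[mu]_x ((w n x - g x) ^+ 2)%:E =
    \int[mu]_x limn_einf (fun j => ((w n x - w (N j) x) ^+ 2)%:E).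
  apply: ae_eq_integral => //.
  - by apply/measurable_EFinP/measurable_funX; exact: measurable_funB.
  - apply: (@emeasurable_fun_cvg _ _ _ setT
      (fun m x => einfs (fun j => ((w n x - w (N j) x) ^+ 2)%:E) m)).
      by move=> m; exact: measurable_fun_einfs.
    by move=> x _; rewrite limn_einf_lim; exact: is_cvg_einfs.
  - apply: filterS aeS => x Sx _ /=.
    apply/esym; apply: (cvg_limn_einf_sup _).1.
    apply/cvg_EFin; first exact: nearW.
    have -> : g x = limn (fun k => w (N k) x).
      rewrite /g /h; congr (limn _); apply/funext => j.
      by rewrite indicE mem_set// mulr1.
    rewrite expr2 [X in X @ _](_ : _ = (fun j => w n x - w (N j) x) \*
      (fun j => w n x - w (N j) x))%R; last first.
      by apply/funext => j; rewrite /= expr2.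
    have cvgd : (w n x - w (N j) x)%R @[j --> \oo] -->
        (w n x - limn (fun k => w (N k) x))%R.
      by apply: cvgB; [exact: cvg_cst|exact: cvgw].
    exact: cvgM.
apply: le_trans (fatou _ _ _ _) _ => //.
  by move=> j x _; rewrite lee_fin sqr_ge0.
rewrite limn_einf_lim; apply: lime_le; first exact: is_cvg_einfs.
apply: nearW => m; apply: ge_ereal_inf.
exists (\int[mu]_x ((w n x - w (N (maxn m k)) x) ^+ 2)%:E).
  by exists (maxn m k) => //=; exact: leq_maxl.
by apply/ltW/HN => //; apply: N0N; exact: leq_maxr.
Qed.

End AeSummable.

(** * The covariance form *)

Section Covariance.
Context d (X : measurableType d) (R : realType) (nu : probability X R).

Lemma one_le_two : (1 <= 2%:E :> \bar R)%E.
Proof. by rewrite lee_fin ler1n. Qed.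

Local Notation L2 := (@Lfunction.type d X R nu 2%:E one_le_two).

Lemma Lfun2_measurable (f : X -> R) :
  f \in Lfun nu 2%:E -> measurable_fun setT f.
Proof. by rewrite inE => /andP[/[!inE]]. Qed.

Lemma sqr_integrable_Lfun2 (f : X -> R) : measurable_fun setT f ->
  (\int[nu]_x (f x ^+ 2)%:E < +oo)%E -> f \in Lfun nu 2%:E.
Proof.
move=> mf foo; rewrite inE; apply/andP; split; rewrite inE//=.
rewrite /finite_norm unlock; apply: poweR_lty.
under eq_integral => x _ do
  rewrite /= [(`|f x| `^ 2)%R](powR_mulrn 2)// real_normK ?num_real//.
exact: foo.
Qed.

Lemma LfunBE (f g : L2) x : (f - g) x = f x - g x.
Proof. by []. Qed.

Lemma Lfun2B (f g : X -> R) : f \in Lfun nu 2%:E -> g \in Lfun nu 2%:E ->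
  f \- g \in Lfun nu 2%:E.
Proof.
move=> f2 g2.
exact: (LfunP (Lfun_Sub one_le_two f2 - Lfun_Sub one_le_two g2 : L2)).
Qed.

Lemma Lfun2B_cst (c : R) (f : X -> R) :
  f \in Lfun nu 2%:E -> f \- cst c \in Lfun nu 2%:E.
Proof. by move=> f2; apply: Lfun2B => //; exact: Lfun_cst. Qed.

Lemma covariance_fin (f g : X -> R) :
  f \in Lfun nu 2%:E -> g \in Lfun nu 2%:E ->
  covariance nu f g \is a fin_num.
Proof.
move=> f2 g2.
by rewrite covariance_fin_num ?Lfun2_mul_Lfun1// Lfun_subset12 ?fin_num_measure.
Qed.

Definition cov (f g : L2) : R := fine (covariance nu f g).

Lemma covE (f g : L2) : (cov f g)%:E = covariance nu f g.
Proof. by rewrite fineK// covariance_fin//; exact: LfunP. Qed.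

Lemma covC (f g : L2) : cov f g = cov g f.
Proof. by rewrite /cov covarianceC. Qed.

Lemma covD (f g h : L2) : cov (f + g) h = cov f h + cov g h.
Proof.
apply: EFin_inj; rewrite [RHS]EFinD !covE.
by rewrite -covarianceDl//; exact: LfunP.
Qed.

Lemma covZ (c : R) (f h : L2) : cov (c *: f) h = c * cov f h.
Proof.
apply: EFin_inj; rewrite [RHS]EFinM !covE.
have f2 := LfunP f; have h2 := LfunP h.
rewrite -covarianceZl ?Lfun2_mul_Lfun1 ?Lfun_subset12 ?fin_num_measure//.
by congr covariance; apply/funext => x; rewrite /= mulrC.
Qed.

Lemma cov_ge0 (f : L2) : 0 <= cov f f.
Proof. by rewrite -lee_fin covE; exact: variance_ge0. Qed.

(* The null vectors are the constants, so that the Hilbert space of this form is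
   L^2 modulo constants. *)
Definition covariance_form : psd_form L2 := PsdForm covC covD covZ cov_ge0.

Lemma variance_integral (f : X -> R) : covariance nu f f =
  (\int[nu]_x ((f x - fine 'E_nu[f]) ^+ 2)%:E)%E.
Proof. by rewrite unlock unlock; apply: eq_integral => x _; rewrite expr2. Qed.

(** [f] and [f - c] have the same variance, which is the second moment of [f - c] minus the square
    of its mean. *)
Lemma variance_le_sqr (f : X -> R) c : f \in Lfun nu 2%:E ->
  (covariance nu f f <= \int[nu]_x ((f x - c) ^+ 2)%:E)%E.
Proof.
move=> f2; have fc2 := Lfun2B_cst c f2.
have := varianceB_cst_r c f2; rewrite /variance => <-.
have := varianceE fc2; rewrite /variance => ->.
have -> : (\int[nu]_x ((f x - c) ^+ 2)%:E = 'E_nu[(f \- cst c) ^+ 2])%E.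
  by rewrite unlock.
have E1 : ('E_nu[f \- cst c] \is a fin_num)%E.
  by rewrite expectation_fin_num// Lfun_subset12 ?fin_num_measure.
by rewrite -(fineK E1) -EFin_expe leeBlDr// leeDl// lee_fin sqr_ge0.
Qed.

Lemma variance0_ae (f : X -> R) : f \in Lfun nu 2%:E ->
  covariance nu f f = 0%E -> {ae nu, forall x, f x = fine 'E_nu[f]}.
Proof.
move=> f2; rewrite variance_integral => f0.
have mf := Lfun2_measurable f2.
have /ae_eq_integral_abs : measurable_fun setT
    (fun x => ((f x - fine 'E_nu[f]) ^+ 2)%:E).
  by apply/measurable_EFinP/measurable_funX; exact: measurable_funB.
move=> /(_ nu measurableT)[+ _].
under eq_integral do rewrite gee0_abs ?lee_fin ?sqr_ge0//.
move=> /(_ f0); apply: filterS => x /(_ I) /= [] /eqP.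
by rewrite sqrf_eq0 subr_eq0 => /eqP.
Qed.

(** The form ignores constants, so a Cauchy sequence for it need not be Cauchy in L^2; after
    centering it is. Only the upper bound [variance_le_sqr] is needed to return from L^2 to the
    form. *)
Lemma covariance_complete : psd_complete covariance_form.
Proof.
move=> u cu.
have u2 n := LfunP (u n).
have mu n := Lfun2_measurable (u2 n).
have finE (f : L2) : ('E_nu[f] \is a fin_num)%E.
  rewrite expectation_fin_num// Lfun_subset12 ?fin_num_measure//.
  exact: LfunP.
pose w n x := u n x - fine 'E_nu[u n].
have w2 n : w n \in Lfun nu 2%:E by exact: Lfun2B_cst (u2 n).
have [||g mg wg] := @L2_complete _ _ _ nu w.
- by move=> n; exact: Lfun2_measurable.
- move=> e e0; have [N HN] := cu e e0; exists N => m n Nm Nn.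
  have := HN m n Nm Nn; rewrite -lte_fin /= covE variance_integral.
  congr (_ < _)%E; apply: eq_integral => x _.
  have -> : ('E_nu[(u m - u n)%R] = 'E_nu[u m] - 'E_nu[u n])%E.
    by rewrite -expectationB ?Lfun_subset12 ?fin_num_measure.
  rewrite fineB// LfunBE /w; congr (_ ^+ 2)%:E; ring.
have [N0 HN0] := wg 1 ltr01.
have g2 : g \in Lfun nu 2%:E.
  have -> : g = w N0 \- (w N0 \- g) by apply/funext => x /=; rewrite subKr.
  apply: Lfun2B => //; apply: sqr_integrable_Lfun2.
    by apply: measurable_funB => //; exact: Lfun2_measurable.
  exact: lt_trans (HN0 _ (leqnn _)) (ltry _).
exists (Lfun_Sub one_le_two g2) => e e0; have [N HN] := wg e e0.
exists N => n /HN Nn; rewrite -lte_fin /= covE.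
apply: le_lt_trans Nn.
have -> : (\int[nu]_x ((w n x - g x) ^+ 2)%:E =
  \int[nu]_x (((u n - Lfun_Sub one_le_two g2 : L2) x -
    fine 'E_nu[u n]) ^+ 2)%:E)%E.
  apply: eq_integral => x _; rewrite LfunBE /w Lfun_valP.
  by congr (_ ^+ 2)%:E; ring.
by apply: variance_le_sqr; exact: LfunP.
Qed.

End Covariance.

(** * The Koopman representation *)

Lemma ae_forall_countable d (X : measurableType d) (R : realType)
    (mu : {measure set X -> \bar R}) (I : Type) (P : I -> X -> Prop) :
  countable [set: I] -> (forall i, {ae mu, forall x, P i x}) ->
  {ae mu, forall x, forall i, P i x}.
Proof.
move=> /countable_injP[f finj] aeP.
have : {ae mu, forall x, forall n i, f i = n -> P i x}.
  apply/ae_foralln => n.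
  have [[i fi]|nfi] := pselect (exists i, f i = n).
    apply: filterS (aeP i) => x Pix j fj.
    by rewrite (finj j i) ?inE// fi fj.
  by apply: aeW => x i fi; case: nfi; exists i.
by apply: filterS => x Px i; exact: Px.
Qed.

Lemma ae_ge0_integral0 d (X : measurableType d) (R : realType)
    (mu : {measure set X -> \bar R}) (h : X -> R) :
  measurable_fun setT h -> {ae mu, forall x, 0 <= h x} ->
  (\int[mu]_x (h x)%:E = 0)%E -> {ae mu, forall x, h x = 0}.
Proof.
move=> mh h0 ih.
have mEh : measurable_fun setT (EFin \o h) by exact/measurable_EFinP.
have : (\int[mu]_x `|(EFin \o h) x| = 0)%E.
  rewrite -ih; apply: ae_eq_integral => //; first exact: measurableT_comp.
  by apply: filterS h0 => x hx _ /=; rewrite ger0_norm.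
move=> /(ae_eq_integral_abs _ measurableT mEh).
by apply: filterS => x /(_ I) /= [].
Qed.

Section Koopman.
Context (R : realType) (G : groupType) d (X : measurableType d).
Context (nu : probability X R) (a : pmp_space G nu).

Local Notation L2 := (@Lfunction.type d X R nu 2%:E (one_le_two R)).

Lemma ge0_integral_act g (f : X -> \bar R) : measurable_fun setT f ->
  (forall x, 0 <= f x)%E -> (\int[nu]_x f (a g x) = \int[nu]_x f x)%E.
Proof.
move=> mf f0.
have mg := measurable_act a g.
have := @ge0_integral_pushforward _ _ _ _ _ _ mg nu setT f measurableT mf.
rewrite preimage_setT => <- //; apply: eq_measure_integral => A mA _.
exact: act_preserving.
Qed.

Lemma integral_act g (f : X -> \bar R) : measurable_fun setT f ->
  (\int[nu]_x f (a g x) = \int[nu]_x f x)%E.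
Proof.
move=> mf; rewrite [LHS]integralE [RHS]integralE.
rewrite -(ge0_integral_act g (measurable_funepos mf) (funepos_ge0 f)).
rewrite -(ge0_integral_act g (measurable_funeneg mf) (funeneg_ge0 f)).
have -> := funepos_comp f (a g); have -> := funeneg_comp f (a g).
by [].
Qed.

Lemma Lfun2_act g (f : X -> R) :
  f \in Lfun nu 2%:E -> (fun x => f (a g x)) \in Lfun nu 2%:E.
Proof.
move=> f2; have mf := Lfun2_measurable f2.
have mg := measurable_act a g.
apply: sqr_integrable_Lfun2; first exact: measurableT_comp.
rewrite (ge0_integral_act g (f := fun x => (f x ^+ 2)%:E)).
- have /integrableP[_] := Lfun2_integrable_sqr f2.
  by under eq_integral do rewrite gee0_abs ?lee_fin ?sqr_ge0//.
- exact/measurable_EFinP/measurable_funX.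
- by move=> x; rewrite lee_fin sqr_ge0.
Qed.

Lemma expectation_act g (f : X -> R) : measurable_fun setT f ->
  ('E_nu[fun x => f (a g x)] = 'E_nu[f])%E.
Proof.
move=> mf; rewrite unlock (integral_act g (f := EFin \o f))//.
exact/measurable_EFinP.
Qed.

Lemma covariance_act g (f f' : X -> R) :
  measurable_fun setT f -> measurable_fun setT f' ->
  covariance nu (fun x => f (a g x)) (fun x => f' (a g x)) =
  covariance nu f f'.
Proof.
move=> mf mf'; rewrite unlock !expectation_act//.
rewrite -[RHS](expectation_act g)//.
by apply: measurable_funM; apply: measurable_funB.
Qed.

(** The inverse makes this a left action, and makes the translate [f (s^-1 x)] of the averages
    exactly [koopman] at a representative of [s]. *)
Definition koopman g (f : L2) : L2 :=
  Lfun_Sub (one_le_two R) (Lfun2_act g^-1%g (LfunP f)).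

Lemma koopmanE g (f : L2) x : koopman g f x = f (a g^-1%g x).
Proof. by []. Qed.

Lemma koopman1 f : koopman 1%g f = f.
Proof. by apply/LfuneqP => x; rewrite koopmanE invg1 act1. Qed.

Lemma koopmanM g h f : koopman (g * h)%g f = koopman g (koopman h f).
Proof. by apply/LfuneqP => x; rewrite !koopmanE invgM actM. Qed.

Lemma koopman_isom g f f' :
  covariance_form nu (koopman g f) (koopman g f') = covariance_form nu f f'.
Proof.
rewrite /= /cov; congr fine.
by rewrite covariance_act//; apply: Lfun2_measurable; exact: LfunP.
Qed.

Definition koopman_action : isometric_action G (covariance_form nu) :=
  IsometricAction koopman1 koopmanM koopman_isom.

Hypotheses (cG : countable [set: G]) (erg : ergodic a).

(** The intersection [B] of all preimages of [A] is strictly invariant, and [A] exceeds it by a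
    union of null sets indexed by the countable [G]. *)
Lemma ergodic_ae_invariant (A : set X) : measurable A ->
  (forall g, {ae nu, forall x, A x -> A (a g x)}) -> nu A = 0%E \/ nu A = 1%E.
Proof.
move=> mA invA.
have mgA g : measurable (a g @^-1` A).
  by rewrite -[_ @^-1` _]setTI; exact: measurable_act.
pose B := \bigcap_(g : G) (a g @^-1` A).
have mB : measurable B.
  rewrite -[B]setCK setC_bigcap; apply: measurableC.
  by apply: countable_bigcupT_measurable => // g; exact: measurableC.
have invB g : a g @^-1` B = B.
  apply/seteqP; split=> x Bx h _ /=.
    by have := Bx (h * g^-1)%g I; rewrite /= -actM mulgVK.
  by rewrite -actM; exact: Bx.
suff <- : nu B = nu A by exact: erg.
have BA : B `<=` A by move=> x /(_ 1%g I) /=; rewrite act1.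
have AB0 : nu (A `\` B) = 0%E.
  apply/negligibleP; first exact: measurableD.
  apply: negligibleS (ae_forall_countable cG invA) => x [Ax Bx] /=.
  by apply: contra_not Bx => gA g _; exact: gA.
have -> : nu A = (nu (A `\` B) + nu (A `&` B))%E by exact: measureDI.
by rewrite AB0 add0e setIidr.
Qed.

(* [{f > E f}] has measure 0 or 1, so [f - E f] has constant sign and
   integral 0. *)
Lemma ergodic_no_invariant (f : L2) :
  (forall g, cov (koopman g f - f) (koopman g f - f) = 0) -> cov f f = 0.
Proof.
move=> finv; have f2 := LfunP f; have mf := Lfun2_measurable f2.
pose c := fine 'E_nu[f].
have f1 : ((f : X -> R) \in Lfun nu 1).
  by rewrite Lfun_subset12 ?fin_num_measure.
have fE : ('E_nu[f] = c%:E)%E by rewrite fineK// expectation_fin_num.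
have finv_ae g : {ae nu, forall x, f (a g x) = f x}.
  have := variance0_ae (LfunP (koopman g^-1%g f - f)).
  rewrite -covE finv => /(_ erefl).
  (* Zero variance only makes the difference almost everywhere equal to its mean; the mean is 0
     since [f] and its translate have the same expectation. *)
  have -> : ('E_nu[(koopman g^-1%g f - f)%R] = 0)%E.
    rewrite expectationB//; first last.
    - by rewrite Lfun_subset12 ?fin_num_measure//; exact: LfunP.
    have -> : ('E_nu[koopman g^-1%g f] = c%:E)%E.
      by rewrite -fE; exact: (expectation_act (g^-1)^-1%g mf).
    by rewrite fE subee.
  apply: filterS => x; rewrite LfunBE koopmanE invgK => /eqP.
  by rewrite subr_eq0 => /eqP.
have mfc : measurable_fun setT (fun x => f x - c) by exact: measurable_funB.
pose A := [set x | c < f x].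
have mA : measurable A.
  rewrite (_ : A = setT `&` f @^-1` `]c, +oo[%classic); first exact: mf.
  by apply/seteqP; split=> x /=; rewrite in_itv /= andbT => // -[].
have int0 : (\int[nu]_x (f x - c)%:E = 0)%E.
  have -> : (\int[nu]_x (f x - c)%:E = 'E_nu[f \- cst c])%E by rewrite unlock.
  rewrite expectationB ?Lfun_cst// expectation_cst fE subee//.
suff fc0 : {ae nu, forall x, f x - c = 0}.
  apply: EFin_inj; rewrite covE variance_integral -/c.
  rewrite -[RHS](integral0 nu setT); apply: ae_eq_integral => //.
    by apply/measurable_EFinP/measurable_funX.
  by apply: filterS fc0 => x -> _; rewrite expr0n.
have [A0|A1] : nu A = 0%E \/ nu A = 1%E.
- apply: ergodic_ae_invariant => // g.
  by apply: filterS (finv_ae g) => x; rewrite /A /= => ->.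
- suff : {ae nu, forall x, c - f x = 0}.
    by apply: filterS => x /eqP; rewrite subr_eq0 => /eqP ->; rewrite subrr.
  apply: ae_ge0_integral0; first exact: measurable_funB.
    exists A; split => // x /= /negP; rewrite subr_ge0 -ltNge.
    by [].
  have -> : (\int[nu]_x (c - f x)%:E = 'E_nu[cst c \- f])%E by rewrite unlock.
  by rewrite expectationB ?Lfun_cst// expectation_cst fE subee.
- apply: ae_ge0_integral0 => //.
  exists (~` A); split; [exact: measurableC| |].
    apply: etrans (probability_setC nu mA) _.
    by rewrite A1 subee.
  move=> x /= /negP; rewrite subr_ge0 -ltNge /A /= => fc cf.
  by have := lt_trans fc cf; rewrite ltxx.
Qed.

End Koopman.

(** * A strong law of large numbers *)

(** Cauchy-Schwarz against the constant sequence 1. In the induction step, [n x^2 - 2 x S + Q] times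
    [n] is at least [(n x - S)^2], by the hypothesis [S^2 <= n Q]. *)
Lemma sqr_sum_le (R : realFieldType) (I : Type) (r : seq I) (b : I -> R) :
  (\sum_(i <- r) b i) ^+ 2 <= (size r)%:R * \sum_(i <- r) b i ^+ 2.
Proof.
elim: r => [|i r IH]; first by rewrite !big_nil expr0n mulr0.
rewrite !big_cons /= -natr1.
have Q0 : 0 <= \sum_(j <- r) b j ^+ 2 by apply: sumr_ge0 => j _; exact: sqr_ge0.
move: (\sum_(j <- r) b j) (\sum_(j <- r) b j ^+ 2) (b i) IH Q0 => S Q x IH Q0.
move: (size r) IH => n SQ.
rewrite -subr_ge0.
have -> : (n%:R + 1) * (x ^+ 2 + Q) - (x + S) ^+ 2 =
  (n%:R * Q - S ^+ 2) + (n%:R * x ^+ 2 - 2 * x * S + Q) by ring.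
rewrite addr_ge0 ?subr_ge0//.
case: n SQ => [|n] SQ.
  have /eqP : S ^+ 2 = 0 by apply/le_anti; rewrite sqr_ge0 andbT -(mul0r Q).
  by rewrite sqrf_eq0 => /eqP ->; rewrite mul0r mulr0 subrr add0r.
have n0 : 0 < n.+1%:R :> R by rewrite ltr0n.
rewrite -(pmulr_rge0 _ n0).
apply: le_trans (sqr_ge0 (n.+1%:R * x - S)) _; rewrite -subr_ge0.
have -> : n.+1%:R * (n.+1%:R * x ^+ 2 - 2 * x * S + Q) -
  (n.+1%:R * x - S) ^+ 2 = n.+1%:R * Q - S ^+ 2 by ring.
by rewrite subr_ge0.
Qed.

Lemma sum_inv_sqr_le (R : realFieldType) n :
  \sum_(0 <= k < n) (k.+1%:R ^- 2 : R) <= 2.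
Proof.
case: n => [|n]; first by rewrite big_nil.
(* Strengthened so that the induction telescopes: [1/(x+1)^2 <= 1/x - 1/(x+1)]. *)
suff : \sum_(0 <= k < n.+1) (k.+1%:R ^- 2 : R) <= 2 - n.+1%:R^-1.
  by move=> /le_trans; apply; rewrite gerBl invr_ge0.
elim: n => [|n IH]; first by rewrite big_nat1 expr1n invr1; lra.
rewrite big_nat_recr//=; apply: le_trans (lerD IH (lexx _)) _.
rewrite -subr_ge0 -[n.+2%:R]natr1.
have n1 : 0 < n.+1%:R :> R by rewrite ltr0n.
move: (n.+1%:R) n1 => x x0.
have x1 : 0 < x + 1 by rewrite addr_gt0.
have -> : 2 - (x + 1)^-1 - (2 - x^-1 + (x + 1) ^- 2) =
    (x * (x + 1) ^+ 2)^-1.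
  by field; rewrite !gt_eqF.
by rewrite invr_ge0 mulr_ge0 ?exprn_ge0 ?ltW.
Qed.

Lemma sqrtn_ex n : exists k, (k ^ 2 <= n < k.+1 ^ 2)%N.
Proof.
elim: n => [|n [k /andP[kn nk]]]; first by exists 0.
have [nk'|kn'] := ltnP n.+1 (k.+1 ^ 2); first by exists k; rewrite leqW.
by exists k.+1; rewrite kn' (leq_ltn_trans nk)// ltn_sqr.
Qed.

(** For [n] between [(k+1)^2] and [(k+2)^2], [S n] is the sum up to the square plus part of a block
    of [2k+3] terms. With [(x+y)^2 <= 2(x^2+y^2)] and [n >= (k+1)^2], the squared average is at most
    [2 (P k + Q k)]. *)
Lemma block_average_cvg0 (R : realType) (b : nat -> R) :
  let S n := \sum_(0 <= j < n) b j in
  ((S (k.+1 ^ 2)%N / k.+1%:R ^+ 2) ^+ 2 @[k --> \oo] --> 0) ->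
  ((2 * k + 3)%N%:R / k.+1%:R ^+ 4 *
     \sum_(k.+1 ^ 2 <= j < k.+2 ^ 2) b j ^+ 2 @[k --> \oo] --> 0) ->
  n%:R^-1 * S n @[n --> \oo] --> 0.
Proof.
move=> S; set P := fun k => _ => P0; set Q := fun k => _ => Q0.
have bound k n : (k.+1 ^ 2 <= n)%N -> (n < k.+2 ^ 2)%N ->
    (n%:R^-1 * S n) ^+ 2 <= 2 * (P k + Q k).
  move=> kn nk.
  have k0 : 0 < k.+1%:R :> R by rewrite ltr0n.
  have kn0 : 0 < n%:R :> R.
    by rewrite ltr0n; apply: leq_trans kn; rewrite expn_gt0.
  have Sn : S n = S (k.+1 ^ 2)%N + \sum_(k.+1 ^ 2 <= j < n) b j.
    by rewrite /S -big_cat_nat.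
  have Tn : (\sum_(k.+1 ^ 2 <= j < n) b j) ^+ 2 <=
      (2 * k + 3)%N%:R * \sum_(k.+1 ^ 2 <= j < k.+2 ^ 2) b j ^+ 2.
    apply: le_trans (sqr_sum_le _ _) _; rewrite size_iota.
    apply: ler_pM => //; first by apply: sumr_ge0 => j _; exact: sqr_ge0.
      by rewrite ler_nat; nia.
    rewrite [leRHS](big_cat_nat kn (ltnW nk))/= lerDl.
    by apply: sumr_ge0 => j _; exact: sqr_ge0.
  rewrite exprMn exprVn mulrC ler_pdivrMr ?exprn_gt0//.
  apply: (@le_trans _ _ (2 * (S (k.+1 ^ 2)%N ^+ 2 +
    (\sum_(k.+1 ^ 2 <= j < n) b j) ^+ 2))).
    rewrite Sn; move: (S _) (\sum_(_ <= _ < _) _) => x y.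
    by have := sqr_ge0 (x - y); lra.
  apply: (@le_trans _ _ (2 * (P k + Q k) * (k.+1%:R ^+ 2) ^+ 2)); last first.
    have PQ : 0 <= P k + Q k.
      rewrite addr_ge0 ?sqr_ge0// mulr_ge0 ?mulr_ge0 ?invr_ge0 ?exprn_ge0//.
      by apply: sumr_ge0 => j _; exact: sqr_ge0.
    rewrite ler_wpM2l ?mulr_ge0// ler_sqr ?nnegrE// -natrX ler_nat//.
  have -> : 2 * (P k + Q k) * (k.+1%:R ^+ 2) ^+ 2 = 2 * (S (k.+1 ^ 2)%N ^+ 2 +
      (2 * k + 3)%N%:R * \sum_(k.+1 ^ 2 <= j < k.+2 ^ 2) b j ^+ 2).
    by rewrite /P /Q; field; rewrite gt_eqF.
  by rewrite ler_pM2l// lerD2l.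
apply/cvgrPdist_lt => e e0.
have e4 : 0 < e ^+ 2 / 4 by rewrite divr_gt0 ?exprn_gt0.
have /cvgrPdist_lt/(_ _ e4)[K1 _ HK1] := P0.
have /cvgrPdist_lt/(_ _ e4)[K2 _ HK2] := Q0.
(* The successor rules out [n = 0] and matches the shift in [(k+1)^2], so that [k] is at least both
   thresholds. *)
exists ((maxn K1 K2).+1 ^ 2)%N => // n /= Kn.
have [k [kn nk]] : exists k, (k.+1 ^ 2 <= n)%N /\ (n < k.+2 ^ 2)%N.
  have [[|k] /andP[kn nk]] := sqrtn_ex n; last by exists k.
  by have := leq_ltn_trans Kn nk; rewrite ltn_sqr.
have Kk : (maxn K1 K2 <= k)%N.
  by have := leq_ltn_trans Kn nk; rewrite ltn_sqr.
have := bound k n kn nk.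
have := HK1 k (leq_trans (leq_maxl _ _) Kk).
have := HK2 k (leq_trans (leq_maxr _ _) Kk).
rewrite !sub0r !normrN => q p.
have := ler_norm (P k); have := ler_norm (Q k) => q' p' h.
have -> : (`|n%:R^-1 * S n| < e) = ((n%:R^-1 * S n) ^+ 2 < e ^+ 2).
  by rewrite -(real_normK (num_real (_ * _))) ltr_pXn2r// nnegrE ltW.
apply: le_lt_trans h _.
by move: (P k) (Q k) (`|P k|) (`|Q k|) (e ^+ 2) p q p' q' => x y z t w; lra.
Qed.

Section UncorrelatedSLLN.
Context (R : realType) d (X : measurableType d) (nu : probability X R).

Local Notation L2 := (@Lfunction.type d X R nu 2%:E (one_le_two R)).

Variables (u : nat -> L2) (s : R).
Hypothesis var_le : forall k, cov (u k) (u k) <= s.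
Hypothesis uncorr : forall k l, k != l -> cov (u k) (u l) = 0.

Let B := covariance_form nu.
Let c k := fine 'E_nu[u k].
Let U n : L2 := \sum_(0 <= k < n) u k.

Let Lfun1 (f : L2) : (f : X -> R) \in Lfun nu 1.
Proof. by rewrite Lfun_subset12 ?fin_num_measure//; exact: LfunP. Qed.

Lemma cov_sum_uncorrelated n : cov (U n) (U n) <= n%:R * s.
Proof.
have U0 m k : (m <= k)%N -> B (U m) (u k) = 0.
  elim: m => [|m IH] mk; first by rewrite /U big_nil psdf0.
  rewrite /U big_nat_recr// (psdfD B) IH ?(ltnW mk)// add0r.
  by apply: uncorr; rewrite ltn_eqF.
rewrite -[cov _ _]/(B (U n) (U n)).
elim: n => [|n IH]; first by rewrite /U big_nil mul0r (psdf0 B).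
rewrite /U big_nat_recr// -/(U n) (psdfD B) !(psdfDr B).
rewrite (U0 n n)// (psdfC B (u n)) (U0 n n)// addr0 add0r.
rewrite -[n.+1%:R]natr1 mulrDl mul1r.
exact: (lerD IH (var_le n)).
Qed.

Lemma center_sum n x :
  U n x - fine 'E_nu[U n] = \sum_(0 <= k < n) (u k x - c k).
Proof.
elim: n => [|n IH].
  rewrite /U !big_nil (_ : 'E_nu[(0 : L2)] = 0)%E ?subrr//.
  exact: expectation_cst.
rewrite [RHS]big_nat_recr//= -IH /U big_nat_recr//= -/(U n).
rewrite (_ : 'E_nu[(U n + u n)%R] = 'E_nu[U n] + 'E_nu[u n])%E; last first.
  exact: (expectationD (Lfun1 (U n)) (Lfun1 (u n))).
rewrite fineD ?expectation_fin_num//.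
rewrite -[X in X - _]/(U n x + u n x).
by rewrite opprD addrACA.
Qed.

(** Both quantities in [block_average_cvg0] have integrals at most a constant times [1/(k+1)^2]. For
    [P], the variance of [(k+1)^2] uncorrelated terms is at most [(k+1)^2 s], to be divided by
    [(k+1)^4]. *)
Lemma uncorrelated_slln : {ae nu, forall x,
  n%:R^-1 * \sum_(0 <= k < n) (u k x - c k) @[n --> \oo] --> 0}.
Proof.
have mfun (f : L2) (r : R) : measurable_fun setT (fun x => f x - r).
  by apply: measurable_funB => //; exact: Lfun2_measurable (LfunP f).
have var_int (f : L2) :
    (\int[nu]_x ((f x - fine 'E_nu[f]) ^+ 2)%:E = (cov f f)%:E)%E.
  by rewrite covE variance_integral.
have s0 : 0 <= s by apply: le_trans (var_le 0); exact: cov_ge0.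
pose P k x := ((\sum_(0 <= j < k.+1 ^ 2) (u j x - c j)) / k.+1%:R ^+ 2) ^+ 2.
pose Q k x := (2 * k + 3)%N%:R / k.+1%:R ^+ 4 *
     \sum_(k.+1 ^ 2 <= j < k.+2 ^ 2) (u j x - c j) ^+ 2.
have summable (f : nat -> \bar R) (C : R) : 0 <= C -> (forall k, 0 <= f k)%E ->
    (forall k, f k <= (C * k.+1%:R ^- 2)%:E)%E ->
    (\sum_(0 <= k <oo) f k < +oo)%E.
  move=> C0 f0 fC; apply: (@le_lt_trans _ _ (C * 2)%:E); last exact: ltry.
  apply: nneseries_le => // n.
  apply: (@le_trans _ _ (\sum_(0 <= k < n) (C * k.+1%:R ^- 2)%:E)%E).
    by apply: lee_sum.
  rewrite sumEFin lee_fin -mulr_sumr ler_wpM2l//; exact: sum_inv_sqr_le.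
have aeP : {ae nu, forall x, P k x @[k --> \oo] --> 0}.
  apply: ae_cvg0.
  - move=> k; apply: measurable_funX; apply: measurable_funM => //.
    by apply: measurable_sum => j.
  - by move=> k x; exact: sqr_ge0.
  - apply: (@summable _ s) => // [k|k].
      by apply: integral_ge0 => x _; rewrite lee_fin sqr_ge0.
    have c0 : 0 < k.+1%:R :> R by rewrite ltr0n.
    under eq_integral => x _ do rewrite /P -center_sum expr_div_n mulrC EFinM.
    rewrite ge0_integralZl//; last 2 first.
    - by apply/measurable_EFinP/measurable_funX.
    - by move=> x _; rewrite lee_fin sqr_ge0.
    rewrite var_int -EFinM lee_fin ler_pdivrMl ?exprn_gt0//.
    apply: le_trans (cov_sum_uncorrelated _) _.
    rewrite natrX le_eqVlt; apply/orP; left; apply/eqP.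
    by field; rewrite gt_eqF.
have aeQ : {ae nu, forall x, Q k x @[k --> \oo] --> 0}.
  apply: ae_cvg0.
  - move=> k; apply: measurable_funM => //.
    by apply: measurable_sum => j; exact: measurable_funX.
  - move=> k x; rewrite mulr_ge0 ?mulr_ge0 ?invr_ge0 ?exprn_ge0//.
    by apply: sumr_ge0 => j _; exact: sqr_ge0.
  (* The factor [2k+3] occurs twice, as a weight and as the length of the block, and
     [2k+3 <= 3(k+1)] gives [9 = 3^2]. *)
  - apply: (@summable _ (9 * s)) => // [|k|k].
    - by rewrite mulr_ge0.
    - apply: integral_ge0 => x _; rewrite lee_fin.
      rewrite mulr_ge0 ?mulr_ge0 ?invr_ge0 ?exprn_ge0//.
      by apply: sumr_ge0 => j _; exact: sqr_ge0.
    have c0 : 0 < k.+1%:R :> R by rewrite ltr0n.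
    have ck : 0 <= (2 * k + 3)%N%:R / k.+1%:R ^+ 4 :> R.
      by rewrite mulr_ge0 ?invr_ge0 ?exprn_ge0.
    under eq_integral => x _ do rewrite /Q EFinM -sumEFin.
    rewrite ge0_integralZl//; last 2 first.
    - by apply: emeasurable_sum => j; apply/measurable_EFinP/measurable_funX.
    - by move=> x _; apply: sume_ge0 => j _; rewrite lee_fin sqr_ge0.
    rewrite ge0_integral_sum//; last 2 first.
    - by move=> j; apply/measurable_EFinP/measurable_funX.
    - by move=> j x _; rewrite lee_fin sqr_ge0.
    under eq_bigr => j _ do rewrite var_int.
    rewrite sumEFin -EFinM lee_fin.
    apply: (@le_trans _ _
      ((2 * k + 3)%N%:R / k.+1%:R ^+ 4 * ((2 * k + 3)%N%:R * s))).
      rewrite ler_wpM2l//; apply: le_trans (ler_sum _ (fun j _ => var_le j)) _.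
      rewrite big_const_nat iter_addr_0 -[leLHS]mulr_natl.
      by rewrite ler_wpM2r// ler_nat; nia.
    have m3 : (2 * k + 3)%N%:R <= 3 * k.+1%:R :> R.
      by rewrite -natrM ler_nat; lia.
    have m0 : 0 <= (2 * k + 3)%N%:R :> R by [].
    have -> : 9 * s * k.+1%:R ^- 2 = (3 * k.+1%:R) ^+ 2 * (s / k.+1%:R ^+ 4).
      by field; rewrite gt_eqF.
    have -> : (2 * k + 3)%N%:R / k.+1%:R ^+ 4 * ((2 * k + 3)%N%:R * s) =
        (2 * k + 3)%N%:R ^+ 2 * (s / k.+1%:R ^+ 4) by ring.
    rewrite ler_wpM2r ?mulr_ge0 ?invr_ge0 ?exprn_ge0//.
    by rewrite ler_sqr ?nnegrE// mulr_ge0.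
move: aeP aeQ; apply: filterS2 => x Px Qx.
exact: block_average_cvg0 Px Qx.
Qed.

End UncorrelatedSLLN.

(** * Averages over cosets *)

(** List [F 0], then append [F (n+1)] minus [F n] at each stage: every list is a prefix of the next,
    so all are initial segments of one sequence. Strictness makes the lengths unbounded, hence [e]
    total. *)
Lemma fset_chain_enum (K : choiceType) (F : nat -> {fset K}) :
  (forall n, F n `<` F n.+1)%fset ->
  exists2 e : nat -> K, injective e &
    forall n, perm_eq (F n) [seq e k | k <- iota 0 #|` F n|].
Proof.
move=> FS.
pose l := fix l n : seq K :=
  if n is m.+1 then l m ++ enum_fset (F m.+1 `\` F m)%fset
  else enum_fset (F 0%N).
have lS n : l n.+1 = l n ++ enum_fset (F n.+1 `\` F n)%fset by [].
have Fsub n : (F n `<=` F n.+1)%fset by exact: fproper_sub.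
have lP n : uniq (l n) /\ l n =i F n.
  elim: n => [|n [ul lF]]; first by split=> //=; exact: fset_uniq.
  split.
    rewrite lS cat_uniq ul fset_uniq andbT /=; apply/hasPn => x /=.
    by rewrite in_fsetD lF => /andP[].
  move=> x; rewrite lS mem_cat lF in_fsetD.
  have [xF|//] := boolP (x \in F n); first by rewrite (fsubsetP (Fsub n)).
have lperm n : perm_eq (F n) (l n).
  by have [ul lF] := lP n; rewrite uniq_perm ?fset_uniq// => x; rewrite lF.
have sl n : size (l n) = #|` F n|.
  by rewrite cardfE -(perm_size (lperm n)) cardfE.
have nF n : (n <= size (l n))%N.
  elim: n => // n IH; rewrite sl.
  apply: leq_ltn_trans (fproper_ltn_card (FS n)).
  by rewrite -sl.
(* A default for [nth]: [F 0] may be empty, but [F 1] is not. *)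
have [x0 _] : exists x, x \in l 1%N.
  by have := nF 1%N; case: (l 1%N) => // x s _; exists x; rewrite mem_head.
have pre m n : exists s, l (m + n)%N = l m ++ s.
  elim: n => [|n [s IH]]; first by exists [::]; rewrite addn0 cats0.
  by rewrite addnS lS IH -catA; eexists.
have nthl m n k : (k < size (l m))%N -> (k < size (l n))%N ->
    nth x0 (l m) k = nth x0 (l n) k.
  wlog mn : m n / (m <= n)%N.
    by move=> H km kn; have [/H->//|/ltnW/H->//] := leqP m n.
  move=> km _; rewrite -(subnKC mn); have [s ->] := pre m (n - m)%N.
  by rewrite nth_cat km.
(* The list of stage [k+1] has at least [k+1] entries, so position [k] exists. *)
pose e k := nth x0 (l k.+1) k.
have eE n k : (k < size (l n))%N -> e k = nth x0 (l n) k.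
  by move=> kn; apply: nthl => //; exact: nF.
exists e.
  move=> j k.
  rewrite (eE (maxn j k).+1 j) ?(eE (maxn j k).+1 k); last 2 first.
  - by apply: leq_trans (nF _); rewrite ltnS leq_maxr.
  - by apply: leq_trans (nF _); rewrite ltnS leq_maxl.
  move/eqP; rewrite nth_uniq; last 3 first.
  - by apply: leq_trans (nF _); rewrite ltnS leq_maxl.
  - by apply: leq_trans (nF _); rewrite ltnS leq_maxr.
  - exact: (lP _).1.
  by move/eqP.
move=> n; rewrite (_ : [seq _ | _ <- _] = l n)//.
apply: (@eq_from_nth _ x0); first by rewrite size_map size_iota sl.
move=> i; rewrite size_map size_iota => iF.
by rewrite (nth_map 0%N) ?size_iota// nth_iota// add0n (eE n)// sl.
Qed.

Section RealCosetAverage.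
Context (R : realType) (G : groupType) (H : groupClosed G).
Context d (X : measurableType d) (nu : probability X R) (a : pmp_space G nu).
Hypotheses (cG : countable [set: G]) (rigH : rigid_pair R H) (erg : ergodic a).
Variables (f : X -> R).
Hypotheses (mf : measurable_fun setT f)
  (f2 : (\int[nu]_x (f x ^+ 2)%:E < +oo)%E)
  (fH : forall h, h \in H -> {ae nu, forall x, f (a h x) = f x}).

Local Notation L2 := (@Lfunction.type d X R nu 2%:E (one_le_two R)).

Let v : L2 := Lfun_Sub (one_le_two R) (sqr_integrable_Lfun2 mf f2).

(** Moving the first translation across the form leaves the correlation of [v] with its translate by
    [g^-1 g'], where rigidity applies. *)
Lemma cov_translates_eq0 g g' : (g^-1 * g')%g \notin H ->
  cov (koopman a g v) (koopman a g' v) = 0.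
Proof.
move=> gg'.
rewrite -[LHS]/(covariance_form nu (koopman_action a g v)
  (koopman_action a g' v)).
rewrite iactV -iactM.
apply: (rigid_pair_orthogonal rigH (@covariance_complete _ _ _ nu)) gg'.
  exact: ergodic_no_invariant.
move=> h hH.
apply/le_anti; rewrite psdf_ge0 andbT -lee_fin [X in (X <= _)%E]covE.
(* With [c = 0] the variance is bounded by the second moment of [koopman h v - v]. This difference
   vanishes almost everywhere by [fH] at [h^-1], the element by which [koopman h] moves points. *)
apply: le_trans (variance_le_sqr 0 (LfunP _)) _.
rewrite -[leRHS](integral0 nu setT).
rewrite le_eqVlt; apply/orP; left; apply/eqP; apply: ae_eq_integral => //.
  apply/measurable_EFinP/measurable_funX; exact: measurable_funB.
have hH' : (h^-1)%g \in H by rewrite gpredV.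
apply: filterS (fH hH') => x fx _.
by rewrite LfunBE koopmanE Lfun_valP fx subrr subr0 expr0n.
Qed.

(** Along the enumeration the translates share mean and variance and are uncorrelated. The average
    over [F n] is term [#|F n|] of their sequence of averages, and [#|F n|] tends to infinity. *)
Lemma real_coset_average (r : lcosets H -> G) (F : nat -> {fset lcosets H}) :
  coset_section r -> (forall n, F n `<` F n.+1)%fset ->
  {ae nu, forall x,
    #|` F n|%:R^-1 * \sum_(s <- F n) f (a (r s)^-1%g x) @[n --> \oo] -->
    fine (\int[nu]_x (f x)%:E)}.
Proof.
move=> hr FS; have [e einj eF] := fset_chain_enum FS.
pose u k : L2 := koopman a (r (e k)) v.
(* Distinct indices give distinct cosets, whose representatives are then inequivalent modulo [H]. *)
have uu k l : k != l -> cov (u k) (u l) = 0.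
  move=> kl; apply: cov_translates_eq0; apply: contra kl => kl.
  apply/eqP/einj; rewrite -(hr (e k)) -(hr (e l)); apply/eqmodP.
  exact: kl.
have uE k : 'E_nu[u k]%E = (\int[nu]_x (f x)%:E)%E.
  by rewrite (expectation_act a _ mf) unlock.
have us k : cov (u k) (u k) <= cov v v.
  rewrite -[leLHS]/(covariance_form nu (koopman_action a _ v)
    (koopman_action a _ v)).
  by rewrite iact_isom.
apply: filterS (uncorrelated_slln us uu) => x.
set c := fine _.
under eq_fun do under eq_bigr do rewrite uE -/c.
move=> slln.
have cardF n : (n <= #|` F n|)%N.
  elim: n => // n IH; exact: leq_ltn_trans (fproper_ltn_card (FS n)).
have cardoo : #|` F n| @[n --> \oo] --> \oo.
  apply/cvgnyPge => N; near=> n; apply: leq_trans (cardF n).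
  by near: n; exact: nbhs_infty_ge.
have /(cvgD (cvg_cst c)) := cvg_comp _ _ cardoo slln.
rewrite addr0; apply: cvg_trans; apply: near_eq_cvg; near=> n => /=.
(* True only eventually, since [F 0] may be empty. *)
have Fn0 : #|` F n|%:R != 0 :> R.
  rewrite pnatr_eq0 -lt0n; apply: leq_trans (cardF n).
  by near: n; exact: nbhs_infty_ge.
rewrite fctE /= big_split /= sumrN sumr_const_nat subn0 mulrDr mulrN.
rewrite -[c *+ _]mulr_natl mulKf// addrC subrK (perm_big _ (eF n))/=.
by rewrite big_map /index_iota subn0.
Unshelve. all: by end_near.
Qed.

End RealCosetAverage.

(** * From real to complex values *)

Lemma cvg_complex (R : realType) (z : nat -> R[i]) (l : R[i]) :
  complex.Re (z n) @[n --> \oo] --> complex.Re l ->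
  complex.Im (z n) @[n --> \oo] --> complex.Im l ->
  (fun n => z n : R[i]^o) @ \oo --> (l : R[i]^o).
Proof.
move=> /cvgrPdist_lt re /cvgrPdist_lt im; apply/cvgrPdist_lt => -[e b] eb0.
have [b0 e0] : b = 0 /\ 0 < e.
  by move: eb0; rewrite ltcE /= => /andP[/eqP].
rewrite {}b0 {eb0}.
have e2 : 0 < e / 2 by rewrite divr_gt0.
move: (re _ e2) (im _ e2); apply: filterS2 => n dx dy.
rewrite ltcE normc_def /= eqxx /=; move: dx dy.
case: l (z n) {re im} => x y [x' y'] /= dx dy.
rewrite -[ltRHS]ger0_norm ?(ltW e0)// -sqrtr_sqr ltr_sqrt ?exprn_gt0//.
rewrite -[(x - x') ^+ 2]real_normK ?num_real//.
rewrite -[(y - y') ^+ 2]real_normK ?num_real//.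
have := normr_ge0 (x - x'); have := normr_ge0 (y - y').
move: `|x - x'| `|y - y'| dx dy => p q dp dq q0 p0.
by nra.
Qed.

Lemma complex_sum (R : realType) (I : Type) (s : seq I) (z : I -> R[i]) :
  \sum_(i <- s) z i =
  Complex (\sum_(i <- s) complex.Re (z i)) (\sum_(i <- s) complex.Im (z i)).
Proof.
elim: s => [|i s IH]; first by rewrite !big_nil.
by rewrite !big_cons IH; case: (z i).
Qed.

Lemma coset_averageE (R : realType) (G : groupType) (H : groupClosed G)
    d (X : measurableType d) (nu : probability X R) (a : pmp_space G nu)
    (f : X -> R[i]) (r : lcosets H -> G) (F : {fset lcosets H}) (x : X) :
  coset_average a f r F x =
  Complex (#|` F|%:R^-1 * \sum_(s <- F) complex.Re (f (a (r s)^-1%g x)))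
    (#|` F|%:R^-1 * \sum_(s <- F) complex.Im (f (a (r s)^-1%g x))).
Proof.
rewrite /coset_average complex_sum -(rmorph_nat (real_complex R)) -fmorphV.
by apply/eqP; rewrite eq_complex /= !mul0r subr0 addr0 !eqxx.
Qed.

(** The weights of the averages are real, so they commute with taking real and imaginary parts. Each
    part is dominated by the modulus of [phi] and inherits its invariance, so the real case applies
    to both, outside the union of two null sets. *)
Theorem theorem1p6 (R : realType) (G : groupType) (H : groupClosed G)
    (hG : countable [set: G]) (hGH : rigid_pair R H)
    (d : measure_display) (X : measurableType d) (nu : probability X R)
    (a : pmp_space G nu) (ha : ergodic a)
    (phi : X -> R[i]) (mphi : complex_measurable phi)
    (sphi : square_integrable nu phi) (iphi : essentially_invariant H a phi)
    (r : lcosets H -> G) (hr : coset_section r)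
    (F : nat -> {fset lcosets H}) (hF : forall n, (F n `<` F n.+1)%fset) :
  {ae nu, forall x,
    (fun n => coset_average a phi r (F n) x : R[i]^o) @ \oo -->
      (complex_integral nu phi : R[i]^o)}.
Proof.
have [mre mim] := mphi.
have mphi2 : measurable_fun setT (fun x => ((Normc.normc (phi x)) ^+ 2)%:E).
  have -> : (fun x => ((Normc.normc (phi x)) ^+ 2)%:E) =
      (fun x => (complex.Re (phi x) ^+ 2 + complex.Im (phi x) ^+ 2)%:E).
    apply/funext => x; case: (phi x) => p q /=.
    by rewrite sqr_sqrtr// addr_ge0 ?sqr_ge0.
  by apply/measurable_EFinP/measurable_funD; exact: measurable_funX.
have part2 (f : X -> R) : measurable_fun setT f ->
    (forall x, f x ^+ 2 <= Normc.normc (phi x) ^+ 2) ->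
    (\int[nu]_x (f x ^+ 2)%:E < +oo)%E.
  move=> mf fphi; apply: le_lt_trans sphi; apply: ge0_le_integral => //.
  - by move=> x _; rewrite lee_fin sqr_ge0.
  - by apply/measurable_EFinP/measurable_funX.
  - by move=> x _; rewrite lee_fin.
have re2 x : complex.Re (phi x) ^+ 2 <= Normc.normc (phi x) ^+ 2.
  by case: (phi x) => p q /=; rewrite sqr_sqrtr ?addr_ge0 ?sqr_ge0//
    lerDl sqr_ge0.
have im2 x : complex.Im (phi x) ^+ 2 <= Normc.normc (phi x) ^+ 2.
  by case: (phi x) => p q /=; rewrite sqr_sqrtr ?addr_ge0 ?sqr_ge0//
    lerDr sqr_ge0.
have reH h : h \in H ->
    {ae nu, forall x, complex.Re (phi (a h x)) = complex.Re (phi x)}.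
  by move=> /iphi; apply: filterS => x ->.
have imH h : h \in H ->
    {ae nu, forall x, complex.Im (phi (a h x)) = complex.Im (phi x)}.
  by move=> /iphi; apply: filterS => x ->.
have := real_coset_average hG hGH ha mre (part2 _ mre re2) reH hr hF.
have := real_coset_average hG hGH ha mim (part2 _ mim im2) imH hr hF.
apply: filterS2 => x im re; apply: cvg_complex.
- by under eq_fun do rewrite coset_averageE.
- by under eq_fun do rewrite coset_averageE.
Qed.
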